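(* Let $G$ be a topological group, let $X$ be a compact Hausdorff space, and let $\mathcal{H}$ be any one of the hyperspaces $\mathcal{H}_1,\mathcal{H}_2,\mathcal{H}_3$ of $X$. Let $\theta=(\theta_g,X_g)_{g\in G}$ be a topological partial action of $G$ on $X$. For $g\in G$ set $2^{\theta_g}:\langle X_{g^{-1}}\rangle_{\mathcal{H}}\to\langle X_g\rangle_{\mathcal{H}}$, $A\mapsto\theta_g(A)$. Then $2^{\theta}=(2^{\theta_g},\langle X_g\rangle_{\mathcal{H}})_{g\in G}$ is a topological partial action of $G$ on $\mathcal{H}$, and the following hold: (i) $G*\mathcal{H}$ is open in $G\times\mathcal{H}$ provided that $G*X$ is open in $G\times X$. (ii) If $\theta$ is continuous, then $2^{\theta}$ is continuous. (iii) If $\theta$ is global, then $2^{\theta}$ is global.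
   Context: Partial actions. A (set-theoretic) partial action of a group $G$ on a set $X$ is a partially defined function $\theta:G\times X\dashrightarrow X$, $(g,x)\mapsto g\cdot x$ (write $\exists g\cdot x$ if $g\cdot x$ is defined), such that for all $g,h\in G$, $x\in X$: (PA1) if $\exists g\cdot x$ then $\exists g^{-1}\cdot(g\cdot x)$ and $g^{-1}\cdot(g\cdot x)=x$; (PA2) if $\exists g\cdot(h\cdot x)$ then $\exists (gh)\cdot x$ and $g\cdot(h\cdot x)=(gh)\cdot x$; (PA3) $\exists 1\cdot x$ and $1\cdot x=x$. Put $G*X=\{(g,x)\in G\times X:\exists g\cdot x\}$ (the domain of $\theta$) and $X_g=\{x\in X:\exists g^{-1}\cdot x\}$; then $\theta$ is determined by the bijections $\theta_g:X_{g^{-1}}\to X_g$, $x\mapsto g\cdot x$, and one writes $\theta=(\theta_g,X_g)_{g\in G}$. $\theta$ is global if $G*X=G\times X$. For $G$ a topological group and $X$ a topological space, $G*X$ has the subspace topology of the product $G\times X$; $\theta$ is a topological partial action if every $X_g$ is open in $X$ and every $\theta_g$ is a homeomorphism; such a $\theta$ is continuous if moreover $\theta:G*X\to X$ is continuous. The same terminology is used for partial actions on $\mathcal{H}$; in particular $G*\mathcal{H}=\{(g,A)\in G\times\mathcal{H}: A\in\langle X_{g^{-1}}\rangle_{\mathcal{H}}\}$ is the domain of $2^\theta$. Hyperspaces. $\mathcal{H}_1=2^X$ is the set of non-empty compact subsets of $X$, with the Vietoris topology, generated by the sets $\langle U_1,\dots,U_n\rangle_{\mathcal{H}_1}=\{A\in\mathcal{H}_1: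 A\subseteq\bigcup_{i=1}^nU_i,\ A\cap U_i\ne\emptyset\ (1\le i\le n)\}$ for non-empty open $U_1,\dots,U_n\subseteq X$; $\langle\emptyset\rangle:=\emptyset$. $\mathcal{H}_2=\{C\in\mathcal{H}_1: C\text{ connected}\}$ and $\mathcal{H}_3=\{F\in\mathcal{H}_1: F\text{ finite}\}$ carry the subspace topology, and $\langle U_1,\dots,U_n\rangle_{\mathcal{H}_i}=\mathcal{H}_i\cap\langle U_1,\dots,U_n\rangle_{\mathcal{H}_1}$. In particular $\langle U\rangle_{\mathcal{H}}=\{A\in\mathcal{H}:A\subseteq U\}$. *)

(* Defs.v *)
From HB Require Import structures.
From mathcomp Require Import all_boot all_order all_algebra.
From mathcomp Require Import all_classical all_analysis.

Set Implicit Arguments.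
Unset Strict Implicit.
Unset Printing Implicit Defensive.

Local Open Scope classical_set_scope.

(* The library only has topological groups in additive, abelian form
   (topologicalZmodType); no separation axiom is imposed here. *)
HB.mixin Record isTopologicalGroup G of Group G & Topological G := {
  mulg_continuous : continuous (fun p : G * G => (p.1 * p.2)%g);
  invg_continuous : continuous (fun x : G => (x^-1)%g)
}.

#[short(type="topologicalGroupType")]
HB.structure Definition TopologicalGroup :=
  {G of Group G & Topological G & isTopologicalGroup G}.

(* A partially defined function G * X -> X is a function th : G -> X -> option X;
   th g x = None means that g . x is undefined. *)

Section PartialAction.
Context {G : groupType} {X : Type}.
Implicit Types (th : G -> X -> option X) (g h : G) (x y z : X).

Record partial_action th : Prop := PartialAction {
  pact_inv : forall g x y, th g x = Some y -> th (g^-1)%g y = Some x;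
  pact_mul : forall g h x y z,
    th h x = Some y -> th g y = Some z -> th (g * h)%g x = Some z;
  pact_one : forall x, th 1%g x = Some x
}.

(* G * X *)
Definition pact_graph th : set (G * X) := [set p | isSome (th p.1 p.2)].

(* X_g *)
Definition pact_dom th g : set X := [set x | isSome (th (g^-1)%g x)].

(* g . x; the value x returned when g . x is undefined is a dummy, so this
   function is only meaningful on X_{g^-1}. *)
Definition pact_map th g x : X := odflt x (th g x).

Definition global th : Prop := pact_graph th = setT.

End PartialAction.

(* f restricts to a homeomorphism from A onto B (subspace topologies). *)
Definition homeo_on (X : topologicalType) (A B : set X) (f : X -> X) : Prop :=
  [/\ set_bij A B f, {within A, continuous f} &
      exists h : X -> X,
        (forall x, A x -> h (f x) = x) /\ {within B, continuous h}].

Definition topological_partial_action (G : groupType) (X : topologicalType)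
    (th : G -> X -> option X) : Prop :=
  [/\ partial_action th,
      forall g, open (pact_dom th g) &
      forall g, homeo_on (pact_dom th (g^-1)%g) (pact_dom th g) (pact_map th g)].

Definition continuous_partial_action (G : topologicalGroupType)
    (X : topologicalType) (th : G -> X -> option X) : Prop :=
  topological_partial_action th /\
  {within pact_graph th, continuous (fun p : G * X => pact_map th p.1 p.2)}.

(* 2^X *)
Record compacts (X : topologicalType) := Compacts {
  compacts_set :> set X;
  compacts_compact : compact compacts_set;
  compacts_nonempty : compacts_set !=set0
}.

HB.instance Definition _ (X : topologicalType) := gen_eqMixin (compacts X).
HB.instance Definition _ (X : topologicalType) := gen_choiceMixin (compacts X).

(* <U_1, ..., U_n> in 2^X *)
Definition vietoris_box (X : topologicalType) n (U : 'I_n -> set X) :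
    set (compacts X) :=
  [set A | A `<=` \bigcup_i U i /\ forall i, (A `&` U i) !=set0].

Definition vietoris_boxes (X : topologicalType) : set (set (compacts X)) :=
  [set W | exists n (U : 'I_n.+1 -> set X),
     (forall i, open (U i) /\ U i !=set0) /\ W = vietoris_box U].

HB.instance Definition _ (X : topologicalType) :=
  isSubBaseTopological.Build (compacts X) (@vietoris_boxes X) id.

Variant hyperkind := AllCompacts | ConnectedCompacts | FiniteCompacts.

Definition hyperset (X : topologicalType) (k : hyperkind) : set (compacts X) :=
  match k with
  | AllCompacts => setT
  | ConnectedCompacts => [set A | connected (A : set X)]
  | FiniteCompacts => [set A | finite_set (A : set X)]
  end.

Arguments hyperset : clear implicits.

(* The set_type of a set carries the subspace topology. *)
Definition hyperspace (X : topologicalType) (k : hyperkind) : topologicalType :=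
  set_type (hyperset X k).

Definition hyper_set (X : topologicalType) k (A : hyperspace X k) : set X :=
  \val A.

(* <U> in the hyperspace *)
Definition hyper_sub (X : topologicalType) k (U : set X) :
    set (hyperspace X k) := [set A | hyper_set A `<=` U].

Arguments hyper_sub {X} k U.

Lemma hyperset_image (X : topologicalType) k (f : X -> X) (A B : compacts X) :
  {within (A : set X), continuous f} -> (B : set X) = f @` A ->
  hyperset X k A -> hyperset X k B.
Proof.
move=> cf BA; case: k => //= hA; rewrite BA.
- exact: connected_continuous_connected.
- exact: finite_image.
Qed.

Section Induced.
Context {G : groupType} {X : topologicalType} {th : G -> X -> option X}.
Hypothesis th_top : topological_partial_action th.

Section Image.
Context {k : hyperkind} {g : G} {A : hyperspace X k}.
Hypothesis A_dom : hyper_sub k (pact_dom th (g^-1)%g) A.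

Lemma pact_map_within : {within hyper_set A, continuous (pact_map th g)}.
Proof.
have [_ _ /(_ g)[_ cth _]] := th_top.
exact: continuous_subspaceW A_dom cth.
Qed.

Lemma image_compact : compact (pact_map th g @` hyper_set A).
Proof.
apply: continuous_compact; first exact: pact_map_within.
exact: compacts_compact.
Qed.

Lemma image_nonempty : (pact_map th g @` hyper_set A) !=set0.
Proof.
have [x Ax] := compacts_nonempty (\val A).
by exists (pact_map th g x), x.
Qed.

Lemma image_hyperset : Compacts image_compact image_nonempty \in hyperset X k.
Proof.
rewrite inE; apply: hyperset_image (set_valP A) => //.
exact: pact_map_within.
Qed.

(* th_g(A) as a point of the hyperspace *)
Definition hyper_image : hyperspace X k :=
  exist (fun B => B \in hyperset X k) _ image_hyperset.

End Image.

(* 2^th: g . A is defined exactly when A lies in <X_{g^-1}>. *)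
Definition hyper_action k (g : G) (A : hyperspace X k) :
    option (hyperspace X k) :=
  match pselect (hyper_sub k (pact_dom th (g^-1)%g) A) with
  | left A_dom => Some (hyper_image A_dom)
  | right _ => None
  end.

End Induced.

(* Main.v *)
Require Import Defs.
From HB Require Import structures.
From mathcomp Require Import all_boot all_order all_algebra.
From mathcomp Require Import finmap.
From mathcomp Require Import all_classical all_analysis.
Set Implicit Arguments.
Unset Strict Implicit.
Unset Printing Implicit Defensive.
Local Open Scope classical_set_scope.

(** The algebraic half is pointwise: applying [th_g] elementwise to sets inherits
    the three axioms of a partial action, and [g . A] is defined exactly when
    [{g} * A] lies in [G * X] (lemma [pact_graph_hyper_action]).

    The topological half rests on one compactness principle, [compact_tube]: a
    property that holds near each point of a compact set [A], uniformly in a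
    parameter tending along a filter, holds on a whole open neighbourhood [U] of
    [A].  Since [{B | B `<=` U}] is a Vietoris neighbourhood of [A], this says
    that the property holds on every [B] near [A] ([near_hyper_sub]).

    - Openness of [G * H] is this principle for the property
      [(t, y) \in G * X], the parameter [t] tending to [g].
    - For continuity it is enough to control the conditions [B `<=` V] and
      [B meets V] with [V] open, because every Vietoris box is an intersection
      of such conditions ([hyper_cvg]).  If [th_g(A) `<=` V], the principle for
      the property [th_t(y) \in V] gives [th_t(B) `<=` V] for [(t, B)] near
      [(g, A)].  If [th_g(x) \in V] for some [x] in [A], then continuity at
      [(g, x)] alone gives a neighbourhood of [x] that [th_t] maps into [V], and
      every [B] close to [A] meets it.  Both arguments are carried out in
      [hyper_image_cvg] relative to the domain of the action, which may fail to
      be open.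

    The parameter is a general filter so that the same lemma gives the
    continuity of each [2^th_g] (a constant parameter) and the joint continuity
    of [2^th] (the neighbourhoods of [g]).  The inverse of [2^th_g] is
    [2^th_(g^-1)], so continuity of all these maps makes them homeomorphisms
    ([continuous_topological_partial_action]). *)

(** * Compactness *)

(** The complements of the sets satisfying [Q] form a filter, possibly improper.
    Locally every point of [K] stays away from it, so by compactness [K] itself
    does: the complement of [K] is in the filter. *)
Lemma compact_induction (X : topologicalType) (K : set X) (Q : set X -> Prop) :
  Q set0 -> (forall A B, Q A -> Q B -> Q (A `|` B)) ->
  (forall A B, A `<=` B -> Q B -> Q A) ->
  (forall x, K x -> exists2 U, nbhs x U & Q U) ->
  compact K -> Q K.
Proof.
move=> Q0 QU Qsub Qloc /compact_near_coveringP Kcov.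
pose F : set_system X := [set S | Q (~` S)].
have FF : Filter F.
  split; first by rewrite /F /= setCT.
    by move=> A B QA QB; have := QU _ _ QA QB; rewrite -setCI.
  by move=> A B AB; apply: Qsub; exact: subsetC.
have : \forall y \near F, K `<=` [set x | x != y].
  apply: Kcov => x /Qloc[U xU QU'].
  exists (U, ~` U); first by split => //; rewrite /F /nbhs /= setCK.
  by move=> [x' y] /= [Ux' nUy]; apply/eqP => xy; apply: nUy; rewrite -xy.
by apply: Qsub => x Kx /(_ x Kx); rewrite /= eqxx.
Qed.

(** The tube lemma, with the neighbourhoods of the slice point replaced by an
    arbitrary filter. *)
Lemma compact_tube (I : Type) (F : set_system I) {FF : Filter F}
    (X : topologicalType) (K : set X) (P : I -> X -> Prop) :
  compact K ->
  (forall x, K x -> \forall i \near F & y \near x, P i y) ->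
  exists U, [/\ open U, K `<=` U & \forall i \near F, U `<=` P i].
Proof.
move=> Kco KP.
pose Q (S : set X) :=
  exists U, [/\ open U, S `<=` U & \forall i \near F, U `<=` P i].
apply: (@compact_induction X K Q) => //.
- exists set0; split => //; [exact: open0 | by apply: filterE => i].
- move=> A B [U [Uop AU FU]] [V [Vop BV FV]]; exists (U `|` V); split.
  + exact: openU.
  + exact: setUSS.
  + by apply: filterS2 FU FV => i UP VP; rewrite subUset.
- by move=> A B AB [U [Uop BU FU]]; exists U; split => //; exact: subset_trans BU.
- move=> x Kx; have [[N V] /= [FN xV] NVP] := KP x Kx.
  exists V° => //; first exact: nbhs_interior.
  exists V°; split => //; first exact: open_interior.
  apply: filterS FN => i Ni y /interior_subset Vy; exact: (NVP (i, y)).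
Qed.

(** * The Vietoris topology *)

Definition hyper_meet (X : topologicalType) k (U : set X) :
    set (hyperspace X k) := [set A | hyper_set A `&` U !=set0].

Arguments hyper_meet {X} k U.

Section Vietoris.
Context {X : topologicalType}.
Implicit Types (k : hyperkind) (U : set X).

Lemma hyper_set_inj k : injective (@hyper_set X k).
Proof.
move=> [[A cA nA] hA] [[B cB nB] hB]; rewrite /hyper_set /= => AB.
apply: val_inj => /=; move: AB cB nB {hB}; case: B / => cB nB.
by congr Compacts; exact: Prop_irrelevance.
Qed.

Lemma hyper_set_compact k (A : hyperspace X k) : compact (hyper_set A).
Proof. exact: compacts_compact. Qed.

Lemma hyper_set_nonempty k (A : hyperspace X k) : hyper_set A !=set0.
Proof. exact: compacts_nonempty. Qed.

(** The subbase only has boxes with non-empty sides; a box with an empty side is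
    itself empty. *)
Lemma open_vietoris_box n (U : 'I_n.+1 -> set X) :
  (forall i, open (U i)) -> open (vietoris_box U).
Proof.
move=> Uop.
have [Une|/existsNP[i Ui0]] := pselect (forall i, U i !=set0); last first.
  rewrite [X in open X](_ : _ = set0); first exact: open0.
  by rewrite -subset0 => A [_ /(_ i)[x [_ Uix]]]; apply: Ui0; exists x.
exists [set vietoris_box U]; last by rewrite bigcup_set1.
move=> _ ->; apply: (@finI_from1 _ _ (@vietoris_boxes X) id).
by exists n, U; split.
Qed.

Lemma nbhs_compacts (A : compacts X) (W : set (compacts X)) :
  nbhs A W ->
  exists2 E : {fset set (compacts X)},
    (forall B, B \in E -> vietoris_boxes B /\ B A) &
    \bigcap_(B in [set` E]) B `<=` W.
Proof.
rewrite nbhsE => -[_ [[V Vbase <-] [C VC CA]] VW].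
have [E Ebox EC] := Vbase C VC.
exists E => [B BE|B EB].
  by split; [have := Ebox B BE; rewrite inE | move: CA; rewrite -EC; apply].
by apply: VW; exists C => //; rewrite -EC.
Qed.

Lemma open_hyper_val k (W : set (compacts X)) :
  open W -> open [set A : hyperspace X k | W (\val A)].
Proof. by exists W. Qed.

Lemma open_hyper_sub k U : open U -> open (hyper_sub k U).
Proof.
move=> Uop.
have /open_hyper_val : open (vietoris_box (fun _ : 'I_1 => U)).
  exact: open_vietoris_box.
move=> /(_ k); congr open; apply/seteqP; split=> A /=.
  by move=> [AU _] x /AU[].
move=> AU; split=> [x /AU Ux|_]; first by exists ord0.
by have [x Ax] := hyper_set_nonempty A; exists x; split => //; exact: AU.
Qed.

Lemma open_hyper_meet k U : open U -> open (hyper_meet k U).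
Proof.
move=> Uop.
have /open_hyper_val :
    open (vietoris_box (fun i : 'I_2 => if i == ord0 then setT else U)).
  by apply: open_vietoris_box => i; case: ifP => // _; exact: openT.
move=> /(_ k); congr open; apply/seteqP; split=> A /=.
  by move=> [_ /(_ (lift ord0 ord0))].
move=> AU; split=> [x _|i]; first by exists ord0.
by case: ifP => // _; rewrite setIT; exact: hyper_set_nonempty.
Qed.

(** The sets [hyper_sub k U] and [hyper_meet k U] form a more convenient subbase:
    a box is [hyper_sub] of the union of its sides intersected with [hyper_meet]
    of each side. *)
Lemma hyper_cvg k (S : Type) (F : set_system S) {FF : Filter F}
    (f : S -> hyperspace X k) (A : hyperspace X k) :
  (forall U, open U -> hyper_sub k U A -> \forall s \near F, hyper_sub k U (f s)) ->
  (forall U, open U -> hyper_meet k U A ->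
     \forall s \near F, hyper_meet k U (f s)) ->
  f @ F --> A.
Proof.
move=> Fsub Fmeet W [_ [[V Vop <-] VA VW]].
have /nbhs_compacts[E Ebox EV] : nbhs (\val A) V by exact: open_nbhs_nbhs.
suff : F (\bigcap_(B in [set` E]) [set s | B (\val (f s))]).
  by apply: (@filterS _ F) => s Es; apply: VW; apply: EV => B EB; exact: Es.
apply: filter_bigI => B /Ebox[[n [U [Uo ->]]]] [AU AUi].
have Usub : \forall s \near F, hyper_sub k (\bigcup_i U i) (f s).
  by apply: Fsub => //; apply: bigcup_open => i _; have [] := Uo i.
have Umeet : \forall s \near F, forall i, hyper_meet k (U i) (f s).
  apply: (@filter_forall S _ (fun i s => hyper_meet k (U i) (f s))) => i.
  by apply: Fmeet; [have [] := Uo i | exact: AUi].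
by apply: filterS2 Usub Umeet => s; split.
Qed.

(** The tube lemma read in the hyperspace. *)
Lemma near_hyper_sub k (T : Type) (F : set_system T) {FF : Filter F}
    (P : T -> X -> Prop) (A : hyperspace X k) :
  (forall x, hyper_set A x -> \forall t \near F & y \near x, P t y) ->
  \forall t \near F & B \near A, hyper_set B `<=` P t.
Proof.
move=> AP; have [U [Uop AU FU]] := compact_tube (hyper_set_compact (A := A)) AP.
exists ([set t | U `<=` P t], hyper_sub k U) => /=.
  by split => //; apply: open_nbhs_nbhs; split => //; exact: open_hyper_sub.
by move=> [t B] /= [UP BU]; exact: subset_trans BU UP.
Qed.

(** [Phi] is the direct image along a family of maps [f t], and [f0] its limit as
    [t] follows [F]; only the part of the family defined on [D] counts. *)
Lemma hyper_image_cvg k (T : Type) (F : set_system T) {FF : Filter F}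
    (D : T -> set X) (f : T -> X -> X) (f0 : X -> X)
    (Phi : T -> hyperspace X k -> hyperspace X k) (A B : hyperspace X k) :
  (forall t C, hyper_set C `<=` D t ->
     hyper_set (Phi t C) = f t @` hyper_set C) ->
  hyper_set B = f0 @` hyper_set A ->
  (forall x V, hyper_set A x -> open V -> V (f0 x) ->
     \forall t \near F & y \near x, D t y -> V (f t y)) ->
  (fun p => Phi p.1 p.2) @
    within [set p | hyper_set p.2 `<=` D p.1] (filter_prod F (nbhs A)) --> B.
Proof.
move=> PhiE BE fcont; apply: hyper_cvg => U Uop; rewrite /hyper_sub /hyper_meet /= BE.
  move=> BU.
  have nearA : \forall t \near F & C \near A,
      hyper_set C `<=` [set y | D t y -> U (f t y)].
    apply: near_hyper_sub => x Ax; apply: (fcont x U) => //.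
    by apply: BU; exists x.
  apply: filterS nearA => -[t C] /= CU CD; rewrite PhiE // => _ [y Cy <-].
  by apply: CU => //; exact: CD.
move=> [_ [[x Ax <-] Ux]].
have [[N V] /= [FN xV] NVU] := fcont x U Ax Uop Ux.
exists (N, hyper_meet k V°) => /=.
  split => //; apply: open_nbhs_nbhs; split.
    exact/open_hyper_meet/open_interior.
  by exists x; split => //; exact: xV.
move=> [t C] /= [Nt [y [Cy /interior_subset Vy]]] CD; rewrite PhiE //.
by exists (f t y); split; [exists y | apply: (NVU (t, y)) => //; exact: CD].
Qed.

End Vietoris.

(** * Partial actions *)

Section PartialActions.
Context {G : groupType} {X : Type} {th : G -> X -> option X}.

Lemma pact_mapP g x :
  pact_dom th (g^-1)%g x -> th g x = Some (pact_map th g x).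
Proof. by rewrite /pact_dom /pact_map /= invgK; case: (th g x). Qed.

Hypothesis th_pact : partial_action th.

Lemma pact_dom_value g x y : th g x = Some y -> pact_dom th g y.
Proof. by move=> /(pact_inv th_pact); rewrite /pact_dom /= => ->. Qed.

Lemma pact_mapK g x :
  pact_dom th (g^-1)%g x -> pact_map th (g^-1)%g (pact_map th g x) = x.
Proof.
by move=> /pact_mapP/(pact_inv th_pact); rewrite /(pact_map _ (_^-1)%g) => ->.
Qed.

End PartialActions.

(** The inverse of [th_g] is [th_(g^-1)], so both halves of the homeomorphism
    condition come from the same continuity hypothesis. *)
Lemma continuous_topological_partial_action (G : groupType)
    (X : topologicalType) (th : G -> X -> option X) :
  partial_action th -> (forall g, open (pact_dom th g)) ->
  (forall g, {within pact_dom th (g^-1)%g, continuous (pact_map th g)}) ->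
  topological_partial_action th.
Proof.
move=> th_pact dop thc.
have thM g x : pact_dom th (g^-1)%g x -> pact_dom th g (pact_map th g x).
  by move=> xg; exact: (pact_dom_value th_pact (pact_mapP xg)).
split => // g; split => //.
- split=> [x /thM //|x y /set_mem xg /set_mem yg xy|y yg].
    by rewrite -(pact_mapK th_pact xg) xy pact_mapK.
  have yg' : pact_dom th (g^-1^-1)%g y by rewrite invgK.
  exists (pact_map th (g^-1)%g y); first exact: thM.
  by rewrite -{1}(invgK g) pact_mapK.
- exists (pact_map th (g^-1)%g); split; first by move=> x; exact: pact_mapK.
  by have := thc (g^-1)%g; rewrite invgK.
Qed.

(** * The induced partial action on the hyperspace *)

Section HyperAction.
Context {G : groupType} {X : topologicalType} {th : G -> X -> option X}.
Hypothesis th_top : topological_partial_action th.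
Variable k : hyperkind.

Local Notation Hth := (hyper_action th_top (k := k)).

Lemma hyper_actionP g (A B : hyperspace X k) :
  Hth g A = Some B <->
  hyper_sub k (pact_dom th (g^-1)%g) A /\
  hyper_set B = pact_map th g @` hyper_set A.
Proof.
rewrite /hyper_action; case: pselect => [Ag|nAg]; split.
- by move=> [<-].
- by move=> [_ BA]; congr Some; apply: hyper_set_inj; rewrite BA.
- by [].
- by move=> [].
Qed.

Lemma isSome_hyper_action g (A : hyperspace X k) :
  isSome (Hth g A) <-> hyper_sub k (pact_dom th (g^-1)%g) A.
Proof. by rewrite /hyper_action; case: pselect. Qed.

Lemma pact_dom_hyper_action g : pact_dom Hth g = hyper_sub k (pact_dom th g).
Proof.
apply/seteqP; split=> A.
  by move/isSome_hyper_action; rewrite invgK.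
by move=> Ag; apply/isSome_hyper_action; rewrite invgK.
Qed.

Lemma pact_graph_hyper_action :
  pact_graph Hth = [set p | hyper_set p.2 `<=` [set x | pact_graph th (p.1, x)]].
Proof.
have E g x : pact_dom th (g^-1)%g x = pact_graph th (g, x).
  by rewrite /pact_dom /= invgK.
apply/seteqP; split=> -[g A] /=.
  by move/isSome_hyper_action => Ag x /Ag; rewrite E.
by move=> Ag; apply/isSome_hyper_action => x Ax; rewrite E; exact: Ag.
Qed.

Lemma pact_map_hyper_action g (A : hyperspace X k) :
  hyper_sub k (pact_dom th (g^-1)%g) A ->
  hyper_set (pact_map Hth g A) = pact_map th g @` hyper_set A.
Proof.
move/isSome_hyper_action; rewrite /pact_map.
by case E : (Hth g A) => [B|] // _; have /hyper_actionP[] := E.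
Qed.

Lemma hyper_action_partial_action : partial_action Hth.
Proof.
have [th_pact _ _] := th_top; split.
- move=> g A B /hyper_actionP[Ag BA]; apply/hyper_actionP; split.
    move=> x; rewrite BA invgK => -[a /Ag ag <-].
    exact: (pact_dom_value th_pact (pact_mapP ag)).
  rewrite BA image_comp; apply/seteqP; split=> [x Ax|_ [x Ax <-]] /=.
    by exists x => //; rewrite /= pact_mapK //; exact: Ag.
  by rewrite pact_mapK //; exact: Ag.
- move=> g h A B C /hyper_actionP[Ah BA] /hyper_actionP[Bg CB].
  have ghE x : hyper_set A x ->
      th (g * h)%g x = Some (pact_map th g (pact_map th h x)).
    move=> Ax; apply: (pact_mul th_pact (pact_mapP (Ah _ Ax))).
    by apply: pact_mapP; apply: Bg; rewrite BA; exists x.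
  apply/hyper_actionP; split.
    by move=> x /ghE; rewrite /pact_dom /= invgK => ->.
  rewrite CB BA image_comp; apply: eq_imagel => x /ghE.
  by rewrite /(pact_map _ (g * h)%g) => ->.
- move=> A; apply/hyper_actionP; split.
    by move=> x _; rewrite /pact_dom /= invgK (pact_one th_pact).
  rewrite -[LHS]image_id; apply: eq_imagel => x _.
  by rewrite /pact_map (pact_one th_pact).
Qed.

Lemma pact_map_hyper_action_continuous g :
  {within pact_dom Hth (g^-1)%g, continuous (pact_map Hth g)}.
Proof.
have [_ _ /(_ g)[_ /subspace_continuousP thc _]] := th_top.
rewrite pact_dom_hyper_action; apply/subspace_continuousP => A Ag.
(* A one-point parameter space: only A varies. *)
have := @hyper_image_cvg X k unit (globally setT) _
  (fun=> pact_dom th (g^-1)%g) (fun=> pact_map th g) (pact_map th g)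
  (fun=> pact_map Hth g) A (pact_map Hth g A).
move=> /(_ _ _ _) cvgA; apply: cvg_trans (cvgA _ _ _) => {cvgA}.
- move=> W [[N V] /= [NT AV] NVW]; apply: filterS AV => B VB BD.
  by apply: (NVW (tt, B)) => //; split => //; exact: NT.
- by move=> _ C; exact: pact_map_hyper_action.
- exact: pact_map_hyper_action.
- move=> x V Ax Vop Vx.
  have : nbhs (pact_map th g x) V by exact: open_nbhs_nbhs.
  move=> /(thc x (Ag x Ax)) xV.
  exists (setT, fun y => pact_dom th (g^-1)%g y -> V (pact_map th g y)).
    by split.
  by move=> [t y] [].
Qed.

Lemma hyper_action_topological : topological_partial_action Hth.
Proof.
apply: continuous_topological_partial_action.
- exact: hyper_action_partial_action.
- move=> g; rewrite pact_dom_hyper_action; apply: open_hyper_sub.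
  by have [] := th_top.
- exact: pact_map_hyper_action_continuous.
Qed.

Lemma hyper_action_global : global th -> global Hth.
Proof.
rewrite /global pact_graph_hyper_action => ->.
by apply/seteqP; split.
Qed.

End HyperAction.

(** * Openness of the domain and joint continuity *)

Section HyperContinuous.
Context {G : topologicalGroupType} {X : topologicalType}.
Context {th : G -> X -> option X}.
Hypothesis th_top : topological_partial_action th.
Variable k : hyperkind.

Local Notation Hth := (hyper_action th_top (k := k)).

Lemma open_pact_graph_hyper_action :
  open (pact_graph th) -> open (pact_graph Hth).
Proof.
rewrite pact_graph_hyper_action !openE => Gop [g A] /= Ag.
apply: (@near_hyper_sub X k G (nbhs g) _ (fun t y => pact_graph th (t, y))).
by move=> x /Ag/Gop; rewrite /interior; apply: filterS => -[].
Qed.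

Lemma hyper_action_continuous :
  continuous_partial_action th -> continuous_partial_action Hth.
Proof.
move=> [_ /subspace_continuousP thc]; split; first exact: hyper_action_topological.
have graphE g (C : hyperspace X k) :
    hyper_set C `<=` [set x | pact_graph th (g, x)] ->
    hyper_sub k (pact_dom th (g^-1)%g) C.
  by move=> Cg x /Cg; rewrite /pact_dom /= invgK.
rewrite pact_graph_hyper_action; apply/subspace_continuousP => -[g A] /= Ag.
apply: (@hyper_image_cvg X k G (nbhs g) _
  (fun t => [set y | pact_graph th (t, y)]) (pact_map th) (pact_map th g)
  (pact_map Hth) A).
- by move=> t C /graphE; exact: pact_map_hyper_action.
- exact/pact_map_hyper_action/graphE.
- move=> x V Ax Vop Vx.
  have : nbhs (pact_map th g x) V by exact: open_nbhs_nbhs.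
  by move=> /(thc (g, x) (Ag x Ax)); apply: (@filterS _ (nbhs (g, x))) => -[t y].
Qed.

End HyperContinuous.

Theorem theorem3p2 (G : topologicalGroupType) (X : topologicalType)
    (X_compact : compact [set: X]) (X_hausdorff : hausdorff_space X)
    (k : hyperkind) (th : G -> X -> option X)
    (th_top : topological_partial_action th) :
  [/\ topological_partial_action (hyper_action th_top (k := k)) /\
        (forall g : G, pact_dom (hyper_action th_top (k := k)) g =
                       hyper_sub k (pact_dom th g)),
      open (pact_graph th) -> open (pact_graph (hyper_action th_top (k := k))),
      continuous_partial_action th ->
        continuous_partial_action (hyper_action th_top (k := k)) &
      global th -> global (hyper_action th_top (k := k))].
Proof.
split.
- split; first exact: hyper_action_topological.
  exact: pact_dom_hyper_action.
- exact: open_pact_graph_hyper_action.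
- exact: hyper_action_continuous.
- exact: hyper_action_global.
Qed.
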